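(* Let $1\le\alpha<\beta<\infty$. Suppose $\varphi\colon[0,1]\to[0,\infty)$ is continuous and essentially increasing with $\varphi(1)=1$, the function $x\mapsto\varphi(x)/x^{\beta-\alpha}$ on $(0,1]$ is essentially decreasing, $\mathbf{E}_{\mathrm{Id}^{\alpha}\varphi}$ is an equivalence relation, and for the $\mu$ defined by $\mu(0)=1$ and $$\mu(n)^{\beta}=\varphi(1/2^{n})-\varphi(1/2^{n-1})/2^{\beta-\alpha}\quad(0<n<\omega),$$ there is $L\ge1$ such that $$\mu(n)\le L\cdot\max_{i<n}\mu(i)\frac{2^{(n-i)\alpha/\beta}}{2^{n-i}}\quad(0<n<\omega).$$ Then $\mathbf{E}_{\mathrm{Id}^{\alpha}\varphi}\le_B\mathbf{E}_{\mathrm{Id}^{\beta}}$.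
   Context: For $f\colon[0,1]\to[0,\infty)$, $\mathbf{E}_f$ is the relation on $[0,1]^{\omega}$ given by $(x_n)\,\mathbf{E}_f\,(y_n)\iff\sum_{n<\omega}f(|y_n-x_n|)<\infty$. $\mathrm{Id}^{\beta}$ is the function $x\mapsto x^{\beta}$ and $\mathrm{Id}^{\alpha}\varphi$ is the function $x\mapsto x^{\alpha}\varphi(x)$ on $[0,1]$. For an ordered set $R$, a function $h\colon R\to[0,\infty)$ is essentially increasing if there is $C\ge1$ such that $x\le y$ implies $h(x)\le Ch(y)$, and essentially decreasing if there is $C\ge1$ such that $x\le y$ implies $Ch(x)\ge h(y)$. For equivalence relations $E$ on a Polish space $X$ and $F$ on a Polish space $Y$, $E\le_B F$ means there is a Borel function $\vartheta\colon X\to Y$ with $x\,E\,x'\iff\vartheta(x)\,F\,\vartheta(x')$ for all $x,x'\in X$. *)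

(* Defs.v *)
From HB Require Import structures.
From mathcomp Require Import all_boot all_order all_algebra.
From mathcomp Require Import all_classical all_reals all_analysis.

Set Implicit Arguments.
Unset Strict Implicit.
Unset Printing Implicit Defensive.

Import Order.TTheory GRing.Theory Num.Theory.
Import numFieldTopology.Exports numFieldNormedType.Exports.

Local Open Scope classical_set_scope.
Local Open Scope ring_scope.

(* [0,1] with the subspace topology, and [0,1]^omega with the product
   topology. *)
Definition unit_itv (R : realType) : topologicalType :=
  set_type `[0 : R, 1]%classic.

Definition unit_seq (R : realType) : topologicalType :=
  prod_topology (fun _ : nat => unit_itv R).

(* A function on [0,1] is represented by a total function on R of which only
   the values on [0,1] matter: below, f is only evaluated at |y_n - x_n|, which
   is in [0,1].  For f nonnegative on [0,1] the series, computed in \bar R, is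
   the supremum of its partial sums. *)
Definition E_rel (R : realType) (f : R -> R) (x y : unit_seq R) : Prop :=
  (\sum_(0 <= n <oo) (f `|set_val (y n) - set_val (x n)|)%:E < +oo)%E.

Definition essentially_increasing (R : realType) d (T : porderType d)
    (D : set T) (h : T -> R) : Prop :=
  exists2 C : R, 1 <= C &
    forall x y : T, D x -> D y -> (x <= y)%O -> h x <= C * h y.

Definition essentially_decreasing (R : realType) d (T : porderType d)
    (D : set T) (h : T -> R) : Prop :=
  exists2 C : R, 1 <= C &
    forall x y : T, D x -> D y -> (x <= y)%O -> C * h x >= h y.

(* <<s open >> is the Borel sigma-algebra.  This is measurable_fun setT theta
   for the Borel structures, without requiring X and Y to be pointed types. *)
Definition borel_function (X Y : topologicalType) (theta : X -> Y) : Prop :=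
  forall B : set Y, <<s @open Y >> B -> <<s @open X >> (theta @^-1` B).

(* Meant for equivalence relations on Polish spaces; unit_seq R is Polish. *)
Definition borel_reducible (X Y : topologicalType)
    (E : X -> X -> Prop) (F : Y -> Y -> Prop) : Prop :=
  exists2 theta : X -> Y, borel_function theta &
    forall x x' : X, E x x' <-> F (theta x) (theta x').

(* Main.v *)
Require Import Defs.
From mathcomp Require Import all_boot all_order all_algebra.
From mathcomp Require Import all_classical all_reals all_analysis.
From mathcomp Require Import ring lra.
Import Order.TTheory GRing.Theory Num.Theory.
Import numFieldTopology.Exports numFieldNormedType.Exports.
Local Open Scope classical_set_scope.
Local Open Scope ring_scope.

(* Write f = Id^alpha phi, q = 2^-beta and w_n = 2^(-n alpha) mu(n)^beta.  The
   definition of mu says w_n = f(2^-n) - q f(2^-(n-1)), so that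
   sum_(n <= m) w_n q^(m-n) telescopes to f(2^-m).  Map a point x of [0,1] to
   the sequence of all w_n^(1/beta) sin(2^n x) and w_n^(1/beta) cos(2^n x), up
   to an affine normalization.  If |x - y| is about 2^-m, then scale n
   contributes about w_n q^(m-n) to the beta-th power of the l_beta-distance of
   the images when n <= m, and at most a constant times w_n when n > m; as
   alpha >= 1 and phi is essentially increasing, the latter terms decay
   geometrically and add up to O(f(2^-m)).  Hence that power is comparable to
   f(|x - y|), and applying the map to every coordinate reduces E_f to
   E_(Id^beta). *)

(** * Lifting maps of [0,1] to Borel reductions between sequence spaces *)

Lemma continuous_borel_function (X Y : topologicalType) (theta : X -> Y) :
  continuous theta -> borel_function theta.
Proof.
move=> theta_cont B.
have [sX0 sXC sXU] := smallest_sigma_algebra [set: X] (@open X).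
apply: (@smallest_sub _ _ _ [set A | <<s @open X >> (theta @^-1` A)]).
  split=> /= [|A SA|A SA].
  - by rewrite preimage_set0; exact: sX0.
  - by rewrite setTD preimage_setC -setTD; exact: sXC.
  - by rewrite preimage_bigcup; exact: sXU.
move=> A oA; apply: sub_sigma_algebra; exact: open_comp.
Qed.

(** Each output coordinate [k] depends continuously on the single input coordinate [i k], so the map
    is continuous for the product topology, hence Borel. *)
Lemma unit_seq_borel_lift (R : realType) (i : nat -> nat) (G : nat -> R -> R) :
  (forall k, continuous (G k)) ->
  (forall k x, x \in `[0, 1] -> G k x \in `[0, 1]) ->
  exists2 theta : unit_seq R -> unit_seq R, borel_function theta &
    forall x k, set_val (theta x k) = G k (set_val (x (i k))).
Proof.
move=> G_cont G01.
have in01 (u : unit_itv R) : set_val u \in `[0, 1].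
  by have := set_valP u.
pose theta (x : unit_seq R) : unit_seq R := fun k =>
  exist (fun u : R => u \in `[0 : R, 1]%classic)
    (G k (set_val (x (i k)))) (mem_set (G01 k _ (in01 (x (i k))))).
exists theta; last by [].
apply: continuous_borel_function => x; apply/cvg_sup.
  exact/fmap_filter/nbhs_filter.
move=> k.
pose H (z : unit_seq R) := G k (set_val (z (i k))).
have H_cont : {for x, continuous H}.
  apply: (continuous_comp (f := fun z : unit_seq R => set_val (z (i k)))
    (g := G k)); last exact: G_cont.
  apply: (continuous_comp (f := fun z : unit_seq R => z (i k))
    (g := set_val)); last exact: initial_continuous.
  exact: (@proj_continuous nat (fun=> unit_itv R) (i k)).
(* Two initial topologies are unfolded: [V] is the preimage under the [k]-th projection of [W], and
   [W] is the trace on [0,1] of an open set [D] of reals. *)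
move=> U /= [V [[W [D oD DE] WE] Vx VU]].
have Dx : D (H x) by move: Vx; rewrite -WE /= -DE.
have : nbhs x (H @^-1` D) by apply: H_cont; exact: open_nbhs_nbhs.
apply: filterS => z /= Dz; apply: VU; rewrite -WE /= -DE; exact: Dz.
Qed.

(** Reindexing along the injection [pickle]. The partial inverse [pickle_inv] is [None] exactly off
    the range of [pickle], so the hypothesis says that numbers coding nothing contribute 0. *)
Lemma pickle_sum (R : realType) (T : countType) (h : nat -> \bar R) :
  (forall k, 0 <= h k)%E ->
  (forall k, @pickle_inv T k = None -> h k = 0%E) ->
  (\sum_(0 <= k <oo) h k = \esum_(t in [set: T]) h (pickle t))%E.
Proof.
move=> h_ge0 h_None; rewrite nneseries_esumT//.
rewrite -(reindex_esum [set: T] (range (@pickle T)) _ h); last first.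
  by split=> //= s t _ _; exact: (pcan_inj pickleK_inv).
rewrite [RHS]esum_mkcond; apply: eq_esum => k _.
case: ifPn => // /negP kP; apply: h_None.
case: (pickle_inv k) (@pickle_invK T k) => //= t tk.
by exfalso; apply: kP; rewrite inE; exists t.
Qed.

(** A sequence [x] is sent to the doubly indexed family of all [K t (x n)], flattened into one
    sequence by coding the pairs [(n, t)]. The two-sided comparison at each coordinate [n] then
    passes to the sum over [n]. *)
Lemma E_rel_embedding (R : realType) (T : countType) (K : T -> R -> R)
    (f g : R -> R) (c C : R) :
  0 < c -> g 0 = 0 ->
  (forall x, x \in `[0, 1] -> 0 <= f x) ->
  (forall x, x \in `[0, 1] -> 0 <= g x) ->
  (forall t, continuous (K t)) ->
  (forall t x, x \in `[0, 1] -> K t x \in `[0, 1]) ->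
  (forall x y, x \in `[0, 1] -> y \in `[0, 1] ->
    ((c * f `|y - x|)%:E <=
      \esum_(t in [set: T]) (g `|K t y - K t x|)%:E)%E) ->
  (forall x y, x \in `[0, 1] -> y \in `[0, 1] ->
    (\esum_(t in [set: T]) (g `|K t y - K t x|)%:E <=
      (C * f `|y - x|)%:E)%E) ->
  borel_reducible (@E_rel R f) (@E_rel R g).
Proof.
move=> c_gt0 g0 f_ge0 g_ge0 K_cont K01 lower upper.
have dist01 (x y : R) : x \in `[0, 1] -> y \in `[0, 1] -> `|y - x| \in `[0, 1].
  rewrite !in_itv/= => /andP[x0 x1] /andP[y0 y1].
  by rewrite normr_ge0/= ler_norml; apply/andP; split; lra.
(* Numbers that code no pair receive the constant value 0, which adds only [g 0 = 0] to the
   series. *)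
pose i k := if @pickle_inv (nat * T)%type k is Some p then p.1 else 0%N.
pose G k :=
  if @pickle_inv (nat * T)%type k is Some p then K p.2 else cst (0 : R).
have [|k x x01|theta theta_borel thetaE] := unit_seq_borel_lift R i G.
- move=> k; rewrite /G; case: pickle_inv => [p|]; first exact: K_cont.
  exact: cst_continuous.
- rewrite /G; case: pickle_inv => [p|]; first exact: K01.
  by rewrite in_itv/= lexx ler01.
exists theta => // x y.
have in01 (z : unit_seq R) n : set_val (z n) \in `[0, 1].
  by have := set_valP (z n).
pose S n := (\esum_(t in [set: T])
  (g `|K t (set_val (y n)) - K t (set_val (x n))|)%:E)%E.
have S_ge0 n : (0 <= S n)%E.
  by apply: esum_ge0 => t _; rewrite lee_fin g_ge0// dist01// K01.
(* The sum over codes is a sum over pairs [(n, t)], which by Tonelli is the series of the inner sums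
   [S n]. *)
have -> : E_rel g (theta x) (theta y) <-> (\sum_(0 <= n <oo) S n < +oo)%E.
  rewrite /E_rel (pickle_sum _ (nat * T)%type).
  - rewrite nneseries_esumT// esum_esum; last first.
      by move=> n t _ _; rewrite lee_fin g_ge0// dist01// K01.
    rewrite (_ : _ `*`` _ = [set: nat * T]); last by apply/seteqP; split.
    under eq_esum => p _ do
      rewrite !thetaE /G /i pickleK_inv.
    by [].
  - by move=> k; rewrite lee_fin g_ge0// dist01.
  - by move=> k kN; rewrite !thetaE /G kN subrr normr0 g0.
have f_dist_ge0 n : (0 <= (f `|set_val (y n) - set_val (x n)|)%:E)%E.
  by rewrite lee_fin f_ge0// dist01.
split=> [Ef|].
  (* The sign of [C] is not prescribed, so its absolute value is used to keep the terms
     nonnegative. *)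
  apply: (@le_lt_trans _ _
    (\sum_(0 <= n <oo) (`|C|%:E * (f `|set_val (y n) - set_val (x n)|)%:E))%E).
    apply: lee_nneseries => // n _; apply: (le_trans (upper _ _ _ _)) => //.
    by rewrite -EFinM lee_fin ler_wpM2r ?ler_norm// f_ge0// dist01.
  by rewrite nneseriesZl// lte_mul_pinfty.
move=> Sfin.
apply: (@le_lt_trans _ _ (\sum_(0 <= n <oo) (c^-1%:E * S n))%E).
  apply: lee_nneseries => // n _.
  rewrite -lee_pdivrMl//; last by rewrite invr_gt0.
  by rewrite invrK -EFinM lower.
by rewrite nneseriesZl// lte_mul_pinfty// lee_fin invr_ge0 ltW.
Qed.

(** * Trigonometric estimates and the dyadic scale of a distance *)

Lemma ler_abs_sinB (R : realType) (u v : R) : `|sin u - sin v| <= `|u - v|.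
Proof.
wlog le_uv : u v / u <= v => [th|].
  by case/orP: (le_total u v) => /th //; rewrite (distrC u) (distrC (sin u)).
have [//|w _ e] := @MVT_segment R sin cos u v le_uv.
  by apply: continuous_subspaceT => ?; exact: continuous_sin.
rewrite distrC e normrM (distrC u) ler_piMl// ler_norml cos_geN1 cos_le1//.
Qed.

Lemma ler_abs_cosB (R : realType) (u v : R) : `|cos u - cos v| <= `|u - v|.
Proof.
rewrite -!sinDpihalf (le_trans (ler_abs_sinB _ _ _))//.
by rewrite opprD addrACA subrr addr0.
Qed.

(** By the mean value theorem sin u = u cos w with w in [0,1], and cosine decreases on [0,pi]. *)
Lemma ler_cos1_sin (R : realType) (u : R) : 0 <= u <= 1 -> cos 1 * u <= sin u.
Proof.
move=> /andP[u_ge0 u_le1].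
have [//|w] := @MVT_segment R sin cos 0 u u_ge0.
  by apply: continuous_subspaceT => ?; exact: continuous_sin.
rewrite in_itv/= => /andP[w_ge0 w_le]; rewrite sin0 !subr0 => ->.
have pi_ge1 : 1 <= pi :> R by have := pihalf_ge1 R; lra.
by rewrite ler_wpM2r// leNgt ltr_cos ?in_itv/= ?ler01 ?w_ge0 //= -?leNgt; lra.
Qed.

(** Sine or cosine alone may be stationary, but sin (u - v) is a combination of their two increments
    with coefficients bounded by 1, and it is at least cos 1 times u - v when 0 <= u - v <= 1. *)
Lemma ler_circle_dist (R : realType) (u v : R) : `|u - v| <= 1 ->
  cos 1 * `|u - v| <= `|sin u - sin v| + `|cos u - cos v|.
Proof.
wlog le_uv : u v / v <= u => [th|uv1].
  by case/orP: (le_total u v) => /th //; rewrite (distrC u) (distrC (sin u))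
    (distrC (cos u)).
have d_ge0 : 0 <= u - v by rewrite subr_ge0.
rewrite (le_trans (ler_cos1_sin _ _ _)) ?normr_ge0// ger0_norm//.
rewrite (_ : sin (u - v) =
    (sin u - sin v) * cos v - (cos u - cos v) * sin v); last first.
  by rewrite sinB; ring.
rewrite (le_trans (ler_norm _))// (le_trans (ler_normB _ _))// !normrM.
by rewrite lerD// ler_piMr// ler_norml ?cos_geN1 ?cos_le1 ?sin_geN1 ?sin_le1.
Qed.

Lemma dyadic_scale (R : realType) (r : R) : 0 < r <= 1 ->
  exists m, 2^-1 ^+ m.+1 < r <= 2^-1 ^+ m.
Proof.
move=> /andP[r_gt0 r_le1].
have ex : exists n, 2^-1 ^+ n < r.
  exists (Num.Def.archi_bound r^-1).
  by rewrite exprVn invf_plt ?posrE ?exprn_gt0// upper_nthrootP.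
have [m rm m_min] := ex_minnP ex.
(* The least exponent with 2^-n < r is positive because r <= 1; its predecessor is the scale. *)
case: m => [|m] in rm m_min *; first by move: rm; rewrite expr0 ltNge r_le1.
exists m; rewrite rm leNgt; apply/negP => /m_min.
by rewrite ltnn.
Qed.

(** * Weighted sums over dyadic scales, by telescoping *)

Section DyadicWeights.
Context {R : realType} (q : R) (F w b : nat -> R).
Hypotheses (w_ge0 : forall n, 0 <= w n) (w0 : w 0%N = F 0%N)
  (wS : forall n, w n.+1 = F n.+1 - q * F n) (q_ge0 : 0 <= q)
  (F_ge0 : forall n, 0 <= F n).

Lemma telescope_weights m : \sum_(n < m.+1) w n * q ^+ (m - n) = F m.
Proof.
elim: m => [|m IH]; first by rewrite big_ord1 subnn expr0 mulr1.
rewrite big_ord_recr/= subnn expr0 mulr1 wS -[X in q * X]IH mulr_sumr.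
rewrite [X in X + _](_ : _ = \sum_(i < m.+1) q * (w i * q ^+ (m - i))).
  by ring.
apply: eq_bigr => i _.
by rewrite subSn ?exprS 1?mulrCA// -ltnS.
Qed.

Lemma sum_weights_ge (m : nat) (c : R) :
  (forall n, (n <= m)%N -> c * q ^+ (m - n) <= b n) ->
  c * F m <= \sum_(n < m.+1) w n * b n.
Proof.
move=> b_ge; rewrite -telescope_weights mulr_sumr; apply: ler_sum => n _.
by rewrite mulrCA ler_wpM2l// b_ge// -ltnS.
Qed.

(** Up to scale [m] the telescoping identity gives [A * F m]. Beyond it, [w n <= F n] and [b n <= B]
    leave a geometric series with terms B C 2^-(k+1) [F m], which contributes at most
    [B * C * F m]. *)
Lemma sum_weights_le (m : nat) (A B C : R) :
  0 <= A -> 0 <= B -> 0 <= C ->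
  (forall n, 0 <= b n) ->
  (forall n, (n <= m)%N -> b n <= A * q ^+ (m - n)) ->
  (forall n, b n <= B) ->
  (forall k, F (m + k)%N <= C * 2^-1 ^+ k * F m) ->
  forall N, \sum_(n < N) w n * b n <= (A + B * C) * F m.
Proof.
move=> A_ge0 B_ge0 C_ge0 b_ge0 b_leA b_leB F_le N.
have wF n : w n <= F n.
  by case: n => [|n]; rewrite ?w0// wS gerBl mulr_ge0.
have geo N' : \sum_(n < N') (2^-1 : R) ^+ n.+1 = 1 - 2^-1 ^+ N'.
  elim: N' => [|k IH]; first by rewrite big_ord0 expr0 subrr.
  by rewrite big_ord_recr/= IH exprS; field.
have head : \sum_(n < m.+1) w n * b n <= A * F m.
  rewrite -telescope_weights mulr_sumr; apply: ler_sum => n _.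
  by rewrite mulrCA ler_wpM2l// b_leA// -ltnS.
have tail : \sum_(n < N) w (m.+1 + n)%N * b (m.+1 + n)%N <= B * C * F m.
  apply: (@le_trans _ _ (\sum_(n < N) (B * C * F m) * 2^-1 ^+ n.+1)).
    apply: ler_sum => n _; rewrite -mulrA -[leRHS]mulrA mulrC ler_pM//.
    by rewrite (le_trans (wF _))// addSnnS (le_trans (F_le _))// mulrAC mulrA.
  by rewrite -mulr_sumr geo ler_piMr ?mulr_ge0// gerBl exprn_ge0.
rewrite mulrDl (le_trans _ (lerD head tail))//.
(* Passing to [m.+1 + N] terms, which include the first [N], avoids comparing [N] with [m]. *)
have <- : \sum_(n < m.+1 + N) w n * b n =
    \sum_(n < m.+1) w n * b n + \sum_(n < N) w (m.+1 + n)%N * b (m.+1 + n)%N.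
  by rewrite big_split_ord.
rewrite (big_ord_widen (m.+1 + N)%N (fun n => w n * b n)) ?leq_addl//.
rewrite [leRHS](bigID (fun i : 'I__ => (i < N)%N))/= lerDl.
by rewrite sumr_ge0// => i _; rewrite mulr_ge0.
Qed.

End DyadicWeights.

(** * Oscillation of sine and cosine at each dyadic scale *)

Lemma esum_nat_bool (R : realType) (a : nat -> bool -> \bar R) :
  (forall n s, 0 <= a n s)%E ->
  (\esum_(t in [set: nat * bool]) a t.1 t.2 =
   \sum_(0 <= n <oo) (a n true + a n false))%E.
Proof.
move=> a_ge0; rewrite nneseries_esumT; last by move=> n; exact: adde_ge0.
under [RHS]eq_esum => n _.
  rewrite (_ : (a n true + a n false)%E = \esum_(s in [set: bool]) a n s)%E;
    last first.
    rewrite (esumID [set true])// !setTI esum_set1// (_ : ~` _ = [set false]).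
      by rewrite esum_set1.
    by apply/seteqP; split=> -[]//= /(_ erefl).
  over.
rewrite esum_esum//; congr esum; first by apply/seteqP; split.
Qed.

Lemma powR_exprn (R : realType) (x p : R) n :
  0 <= x -> (x ^+ n) `^ p = (x `^ p) ^+ n.
Proof. by move=> x_ge0; rewrite -!powR_mulrn ?powR_ge0// powRAC. Qed.

Lemma ler_powR_inj (R : realType) (p u v : R) :
  0 < p -> 0 <= u -> 0 <= v -> u `^ p <= v `^ p -> u <= v.
Proof.
move=> p_gt0 u_ge0 v_ge0; rewrite !leNgt; apply: contra.
by apply: gt0_ltr_powR; rewrite ?nnegrE.
Qed.

(** The [p]-th power of the l_p-distance in the plane between the points of the unit circle at
    angles 2^n x and 2^n y. *)
Definition dyadic_osc (R : realType) (p x y : R) (n : nat) : R :=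
  `|sin (2 ^+ n * y) - sin (2 ^+ n * x)| `^ p +
  `|cos (2 ^+ n * y) - cos (2 ^+ n * x)| `^ p.

Section DyadicOsc.
Context {R : realType} (p x y : R) (m : nat).
Hypotheses (p_gt0 : 0 < p) (xy_gt : 2^-1 ^+ m.+1 < `|y - x|)
  (xy_le : `|y - x| <= 2^-1 ^+ m).

Let distX n : `|2 ^+ n * y - 2 ^+ n * x| = 2 ^+ n * `|y - x|.
Proof. by rewrite -mulrBr normrM ger0_norm// exprn_ge0. Qed.

Let half_split n k : (n <= k)%N -> (2^-1 : R) ^+ (k - n) = 2 ^+ n * 2^-1 ^+ k.
Proof.
move=> nk; rewrite -[in RHS](subnKC nk) exprD mulrA -exprMn divff//.
by rewrite expr1n mul1r.
Qed.

Lemma dyadic_osc_ge0 n : 0 <= dyadic_osc R p x y n.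
Proof. by rewrite addr_ge0 ?powR_ge0. Qed.

Lemma dyadic_osc_bounded n : dyadic_osc R p x y n <= 2 * 2 `^ p.
Proof.
rewrite mulr_natl mulr2n lerD// ge0_ler_powR ?nnegrE// ?(ltW p_gt0)//.
  by rewrite (le_trans (ler_normB _ _))// lerD// ler_norml sin_geN1 sin_le1.
by rewrite (le_trans (ler_normB _ _))// lerD// ler_norml cos_geN1 cos_le1.
Qed.

Lemma dyadic_osc_le n : (n <= m)%N ->
  dyadic_osc R p x y n <= 2 * (2^-1 `^ p) ^+ (m - n).
Proof.
move=> nm; rewrite -powR_exprn// half_split// mulr_natl mulr2n.
have le : `|2 ^+ n * y - 2 ^+ n * x| <= 2 ^+ n * 2^-1 ^+ m.
  by rewrite distX ler_pM2l ?exprn_gt0.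
rewrite lerD// ge0_ler_powR ?nnegrE ?(ltW p_gt0)// ?mulr_ge0 ?exprn_ge0//.
  exact: le_trans (ler_abs_sinB _ _ _) le.
exact: le_trans (ler_abs_cosB _ _ _) le.
Qed.

(** With t = 2^-(m-n), the rescaled distance lies between t/2 and 1, so [ler_circle_dist] makes the
    two increments add up to at least (cos 1) t/2. One of them is therefore at least (cos 1) t/4. *)
Lemma dyadic_osc_ge n : (n <= m)%N ->
  (cos 1 / 4) `^ p * (2^-1 `^ p) ^+ (m - n) <= dyadic_osc R p x y n.
Proof.
move=> nm.
have c_gt0 := @cos1_gt0 R.
rewrite -powR_exprn// -powRM ?exprn_ge0// ?divr_ge0 ?(ltW c_gt0)//.
set t := 2^-1 ^+ (m - n).
have t_ge0 : 0 <= t by rewrite exprn_ge0.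
have d_le1 : `|2 ^+ n * y - 2 ^+ n * x| <= 1.
  rewrite distX (@le_trans _ _ t)// ?exprn_ile1// ?invf_le1 ?ler1n//.
  by rewrite /t half_split// ler_pM2l ?exprn_gt0.
have d_ge : t / 2 <= `|2 ^+ n * y - 2 ^+ n * x|.
  by rewrite distX /t half_split// -mulrA ler_pM2l ?exprn_gt0// -exprSr ltW.
have := ler_circle_dist _ _ _ d_le1; rewrite /dyadic_osc.
set u := `|sin _ - _|; set v := `|cos _ - _| => uv.
have {}uv : cos 1 * (t / 2) <= u + v.
  by apply: le_trans uv; rewrite ler_pM2l.
have [u_le|u_gt] := leP (cos 1 / 4 * t) u.
  rewrite ler_wpDr ?powR_ge0// ge0_ler_powR ?nnegrE ?(ltW p_gt0) /u//.
  by rewrite mulr_ge0 ?divr_ge0 ?(ltW c_gt0).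
rewrite ler_wpDl ?powR_ge0// ge0_ler_powR ?nnegrE ?(ltW p_gt0) /v//.
  by rewrite mulr_ge0 ?divr_ge0 ?(ltW c_gt0).
by rewrite -/v; lra.
Qed.

End DyadicOsc.

(** * The reduction built from the weights of [mu] *)

Theorem corollary27 (R : realType) (alpha beta : R) (phi : R -> R)
  (mu : nat -> R)
  (alpha_ge1 : 1 <= alpha) (alpha_lt_beta : alpha < beta)
  (phi_ge0 : forall x, x \in `[0, 1] -> 0 <= phi x)
  (phi_cont : {within `[0, 1], continuous phi})
  (phi_incr : essentially_increasing `[0, 1]%classic phi)
  (phi1 : phi 1 = 1)
  (phi_decr : essentially_decreasing `]0, 1]%classic
                (fun x : R => phi x / x `^ (beta - alpha)))
  (E_equiv : RelationClasses.Equivalence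
               (E_rel (fun x : R => x `^ alpha * phi x)))
  (mu_ge0 : forall n : nat, 0 <= mu n)
  (mu0 : mu 0%N = 1)
  (mu_def : forall n : nat, (0 < n)%N ->
     mu n `^ beta =
       phi (1 / 2 ^+ n) - phi (1 / 2 ^+ n.-1) / 2 `^ (beta - alpha))
  (mu_bound : exists2 L : R, 1 <= L &
     forall n : nat, (0 < n)%N ->
       mu n <= L * \big[Num.max/0]_(i < n)
                     (mu i * (2 `^ ((n - i)%:R * alpha / beta) / 2 ^+ (n - i)))) :
  borel_reducible (E_rel (fun x : R => x `^ alpha * phi x))
                  (E_rel (fun x : R => x `^ beta)).
Proof.
have [C1 C1_ge1 phi_le] := phi_incr; have [C2 C2_ge1 phi_ge] := phi_decr.
have C1_gt0 : 0 < C1 by lra.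
have alpha_gt0 : 0 < alpha by lra.
have beta_gt0 : 0 < beta by lra.
pose h : R := 2^-1; pose q := h `^ beta; pose f x := x `^ alpha * phi x.
have h_gt0 : 0 < h by rewrite invr_gt0.
have h_ge0 := ltW h_gt0.
have h_le1 : h <= 1 by rewrite invf_le1 ?ler1n.
have hX_gt0 n : 0 < h ^+ n by rewrite exprn_gt0.
have hX01 n : h ^+ n \in `[0, 1] by rewrite in_itv/= exprn_ge0// exprn_ile1.
have f_ge0 x : x \in `[0, 1] -> 0 <= f x.
  by move=> x01; rewrite mulr_ge0 ?powR_ge0 ?phi_ge0.
pose F n := f (h ^+ n).
have F_ge0 n : 0 <= F n by exact: f_ge0.
pose w n := (h ^+ n) `^ alpha * mu n `^ beta.
have w_ge0 n : 0 <= w n by rewrite mulr_ge0 ?powR_ge0.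
have w0 : w 0%N = F 0%N by rewrite /w /F /f !expr0 mu0 !powR1 phi1.
have wS n : w n.+1 = F n.+1 - q * F n.
  rewrite /w mu_def// !div1r -!exprVn -/h /F /f mulrBr; congr (_ - _).
  rewrite !powR_exprn// exprS /q.
  (* This turns the factor 2^-(beta-alpha) of [mu_def], multiplied by 2^-alpha, into [q]. *)
  have -> : h `^ beta = h `^ alpha / 2 `^ (beta - alpha).
    rewrite -powRN /h -powR_inv1// -!powRrM -powRD ?pnatr_eq0 ?implybT//.
    by congr powR; ring.
  by rewrite /=; ring.
have q_ge0 : 0 <= q by exact: powR_ge0.
have halpha : h `^ alpha <= h.
  by rewrite -[leRHS]powRr1// ger_powR// h_gt0.
(* The power Id^alpha supplies the factor [h ^+ k] because alpha >= 1; [phi] costs only the constant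
   [C1]. *)
have F_decay m k : F (m + k)%N <= C1 * h ^+ k * F m.
  rewrite /F /f powR_exprn// [in leLHS]exprD -powR_exprn//.
  have : phi (h ^+ (m + k)) <= C1 * phi (h ^+ m).
    apply: phi_le; [exact: hX01|exact: hX01|].
    by rewrite exprD ler_piMr ?exprn_ge0// exprn_ile1.
  have : (h `^ alpha) ^+ k <= h ^+ k by rewrite lerXn2r ?nnegrE ?powR_ge0.
  move=> le1 le2.
  rewrite [leRHS](_ : _ = (h ^+ m) `^ alpha * h ^+ k * (C1 * phi (h ^+ m))).
    by rewrite ler_pM ?mulr_ge0 ?exprn_ge0 ?powR_ge0 ?phi_ge0// ler_wpM2l
      ?powR_ge0.
  by ring.
pose a n := (h ^+ n) `^ (alpha / beta) * mu n.
have a_ge0 n : 0 <= a n by rewrite mulr_ge0 ?powR_ge0.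
have aE n : a n `^ beta = w n.
  by rewrite /a powRM ?powR_ge0// -powRrM divfK// gt_eqF.
(* Compare [beta]-th powers: w n <= F n <= C1 F 0 = C1 <= C1^beta, since C1 >= 1 and beta > 1. *)
have a_le n : a n <= C1.
  apply: (ler_powR_inj _ _ _ _ beta_gt0) => //; first exact: ltW.
  rewrite aE (@le_trans _ _ (F n))//.
    by case: n => [|n]; rewrite ?w0// wS gerBl mulr_ge0.
  rewrite (le_trans (F_decay 0%N n))// /F /f expr0 powR1 phi1 !mulr1.
  rewrite (@le_trans _ _ C1) ?ler_piMr ?exprn_ile1 ?(ltW C1_gt0)//.
  by rewrite -[leLHS]powRr1 ?ler_powR ?(ltW C1_gt0)//; lra.
clearbody a.
pose trig (s : bool) : R -> R := if s then sin else cos.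
(* The boolean selects sine or cosine. Both factors lie in [0,1], and increments of [K] are a n / (2
   C1) times trigonometric ones; the [beta]-th power of 1 / (2 C1) is [kappa]. *)
pose K (t : nat * bool) x := a t.1 / C1 * ((1 + trig t.2 (2 ^+ t.1 * x)) / 2).
pose kappa := ((2 * C1) `^ beta)^-1.
have kappa_gt0 : 0 < kappa by rewrite invr_gt0 powR_gt0// mulr_gt0.
have KE x y : (\esum_(t in [set: nat * bool]) (`|K t y - K t x| `^ beta)%:E =
    \sum_(0 <= n <oo) (kappa * (w n * dyadic_osc R beta x y n))%:E)%E.
  rewrite (esum_nat_bool _
    (fun n s => (`|K (n, s) y - K (n, s) x| `^ beta)%:E)).
  - apply: eq_eseriesr => n _; rewrite -EFinD; congr EFin.
    have E s : `|K (n, s) y - K (n, s) x| `^ beta = kappa * (w n *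
        `|trig s (2 ^+ n * y) - trig s (2 ^+ n * x)| `^ beta).
      rewrite /K /= (_ : _ - _ = (a n / (2 * C1)) *
        (trig s (2 ^+ n * y) - trig s (2 ^+ n * x))); last first.
        by field; rewrite gt_eqF.
      rewrite normrM ger0_norm ?divr_ge0 ?mulr_ge0 ?(ltW C1_gt0)//.
      have M_ge0 : 0 <= 2 * C1 by rewrite mulr_ge0// ltW.
      rewrite powRM ?divr_ge0// [(a n / _) `^ _]powRM ?invr_ge0// aE.
      rewrite -powR_inv1// powRAC powR_inv1 ?powR_ge0// -/kappa.
      by ring.
    by rewrite !E /dyadic_osc /trig; ring.
  - by move=> n s; rewrite lee_fin powR_ge0.
(* The 2 comes from [dyadic_osc_le] at scales up to m; the other term is the bound of
   [dyadic_osc_bounded] times the decay constant [C1], for the finer scales. *)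
pose A := 2 + 2 * 2 `^ beta * C1.
have A_ge0 : 0 <= A.
  by rewrite addr_ge0 ?mulr_ge0 ?powR_ge0 ?(ltW C1_gt0).
pose c := (cos 1 / 4) `^ beta : R.
have c_gt0 : 0 < c by rewrite powR_gt0// divr_gt0// cos1_gt0.
pose D := C2 * 2 `^ beta.
(* Between consecutive powers of 1/2, [f] is constant up to a factor. The first bound uses that
   [phi] is essentially increasing. The second uses that phi(x) / x^(beta-alpha) is essentially
   decreasing, which gives [C2], and h^m <= 2r, which gives 2^beta. *)
have scale (r : R) m : h ^+ m.+1 < r <= h ^+ m ->
    f r <= C1 * F m /\ F m <= D * f r.
  move=> /andP[r_gt r_le].
  have r_gt0 : 0 < r by exact: lt_trans r_gt.
  have r_le1 : r <= 1 by rewrite (le_trans r_le)// exprn_ile1.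
  have r01 : r \in `[0, 1] by rewrite in_itv/= ltW.
  split; rewrite /F /f.
    rewrite mulrCA ler_pM ?powR_ge0 ?phi_ge0//; last first.
      exact: (phi_le _ _ r01 (hX01 m) r_le).
    by rewrite ge0_ler_powR ?nnegrE ?(ltW alpha_gt0)// ltW.
  have r2 : h ^+ m <= 2 * r.
    by rewrite -ler_pdivrMl// mulrC -exprSr ltW.
  have : phi (h ^+ m) / (h ^+ m) `^ (beta - alpha) <=
      C2 * (phi r / r `^ (beta - alpha)).
    apply: phi_ge => //=; rewrite in_itv/= ?r_gt0 ?hX_gt0//.
    by rewrite exprn_ile1.
  rewrite ler_pdivrMr ?powR_gt0// => phi_hm.
  have le3 : (h ^+ m) `^ beta <= 2 `^ beta * r `^ beta.
    by rewrite -powRM ?(ltW r_gt0)// ge0_ler_powR ?nnegrE ?(ltW beta_gt0)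
      ?mulr_ge0 ?(ltW r_gt0) ?(ltW (hX_gt0 _)).
  have hD : (h ^+ m) `^ alpha * (h ^+ m) `^ (beta - alpha) = (h ^+ m) `^ beta.
    by rewrite -powRD ?(gt_eqF (hX_gt0 _)) ?implybT//; congr powR; ring.
  have rD : r `^ beta = r `^ alpha * r `^ (beta - alpha).
    by rewrite -powRD ?(gt_eqF r_gt0) ?implybT//; congr powR; ring.
  apply: (@le_trans _ _
      (C2 * (phi r / r `^ (beta - alpha)) * (h ^+ m) `^ beta)).
    by rewrite -hD mulrCA ler_wpM2l ?powR_ge0.
  apply: (@le_trans _ _
      (C2 * (phi r / r `^ (beta - alpha)) * (2 `^ beta * r `^ beta))).
    by rewrite ler_wpM2l// !mulr_ge0 ?invr_ge0 ?powR_ge0 ?phi_ge0//; lra.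
  rewrite le_eqVlt; apply/orP; left; apply/eqP.
  by rewrite rD /D; field; rewrite gt_eqF// powR_gt0.
clearbody D.
have osc_sum x y : x \in `[0, 1] -> y \in `[0, 1] ->
    ((kappa * c / C1 * f `|y - x|)%:E <=
       \sum_(0 <= n <oo) (kappa * (w n * dyadic_osc R beta x y n))%:E <=
     (kappa * A * D * f `|y - x|)%:E)%E.
  rewrite !in_itv/= => /andP[x0 x1] /andP[y0 y1].
  have term_ge0 n : (0 <= (kappa * (w n * dyadic_osc R beta x y n))%:E)%E.
    by rewrite lee_fin mulr_ge0 ?(ltW kappa_gt0)// mulr_ge0// dyadic_osc_ge0.
  (* Distance 0 has no dyadic scale; there all three quantities vanish, as 0^alpha = 0^beta = 0. *)
  have [->|xy] := eqVneq x y.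
    rewrite eseries0; last first.
      move=> n _ _; rewrite /dyadic_osc !subrr normr0 powR0 ?gt_eqF//.
      by rewrite addr0 !mulr0.
    by rewrite /f subrr normr0 powR0 ?gt_eqF// mul0r !mulr0 lexx.
  have r01 : 0 < `|y - x| <= 1.
    by rewrite normr_gt0 subr_eq0 eq_sym xy/= ler_norml; apply/andP; split; lra.
  have [m /[dup] /andP[r_gt r_le] /scale[f_le F_le]] := dyadic_scale _ _ r01.
  apply/andP; split.
    (* For the lower bound the scales n <= m suffice, the other terms being nonnegative. *)
    apply: (@le_trans _ _
        (\sum_(0 <= n < m.+1) (kappa * (w n * dyadic_osc R beta x y n))%:E)%E).
      rewrite sumEFin big_mkord lee_fin -mulr_sumr -!mulrA ler_pM2l//.
      have := sum_weights_ge q F w (dyadic_osc R beta x y) w_ge0 w0 wS m c.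
      move=> /(_ (fun n => dyadic_osc_ge beta x y m beta_gt0 r_gt r_le n)).
      apply: le_trans.
      by rewrite ler_pM2l// ler_pdivrMl.
    exact: nneseries_lim_ge.
  (* For the upper bound, all partial sums are bounded uniformly in [N]. *)
  apply: lime_le; first exact: is_cvg_nneseries.
  apply: nearW => N.
  rewrite sumEFin big_mkord lee_fin -mulr_sumr -!mulrA ler_pM2l//.
  apply: (@le_trans _ _ (A * F m)); last by rewrite ler_wpM2l.
  apply: (sum_weights_le q F w _ w_ge0 w0 wS q_ge0 F_ge0 m 2 (2 * 2 `^ beta) C1)
    => //.
  - exact: ltW.
  - by move=> n; exact: dyadic_osc_ge0.
  - by move=> n; exact: dyadic_osc_le.
  - by move=> n; exact: dyadic_osc_bounded.
apply: (E_rel_embedding R (nat * bool)%type K f (fun x => x `^ beta)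
  (kappa * c / C1) (kappa * A * D)) => //.
- by rewrite divr_gt0// mulr_gt0.
- by rewrite powR0 ?gt_eqF.
- by move=> x _; rewrite powR_ge0.
- move=> [n s] x; rewrite /K /=.
  apply: cvgMr; apply: cvgMl; apply: cvgD; first exact: cvg_cst.
  apply: (continuous_comp (f := fun z : R => 2 ^+ n * z) (g := trig s)).
    by apply: cvgMr; exact: cvg_id.
  by case: s; [exact: continuous_sin|exact: continuous_cos].
- move=> [n s] x _; rewrite /K /= in_itv/=.
  have : -1 <= trig s (2 ^+ n * x) <= 1.
    by case: s; rewrite /trig ?sin_geN1 ?sin_le1 ?cos_geN1 ?cos_le1.
  move=> /andP[tN1 t1].
  have aC : 0 <= a n / C1 <= 1.
    by rewrite divr_ge0 ?(ltW C1_gt0)// ler_pdivrMr// mul1r a_le.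
  case/andP: aC => aC0 aC1.
  have /andP[b0 b1] : 0 <= (1 + trig s (2 ^+ n * x)) / 2 <= 1.
    by apply/andP; split; lra.
  by rewrite mulr_ge0//= mulr_ile1.
- by move=> x y x01 y01; rewrite KE; case/andP: (osc_sum _ _ x01 y01).
- by move=> x y x01 y01; rewrite KE; case/andP: (osc_sum _ _ x01 y01).
Qed.
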